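(* Let $f\in\mathcal{S}_L$ with $\arg\min f\neq\varnothing$, and fix $x^\star\in\arg\min f$. Let $x_0,y_0\in\mathbb{R}^d$ and let $P_0\in\mathbb{R}^{d\times d}$ be diagonal with $P_0\succ0$. Generate $(x_k,y_k,P_k)$ by $$\frac{x_{k+1}-x_k}{\alpha_k}=y_k-x_{k+1}-\beta_kP_k^{-1}\nabla f(x_k),\qquad \frac{P_{k+1}-P_k}{\widetilde\alpha_k}=-P_k+\gamma_kP_{k+1}^{-1}G_{k+1}^2,$$ $$\frac{y_{k+1}-y_k}{\widetilde\alpha_k}=-P_{k+1}^{-1}\nabla f(x_{k+1}),\qquad G_{k+1}^2=\mathrm{diag}\big((\partial_1 f(x_{k+1}))^2,\dots,(\partial_d f(x_{k+1}))^2\big),$$ where $P_{k+1}$ is the positive definite diagonal solution of its equation, the method being terminated at the first index $\ell$ with $\nabla f(x_\ell)=0$, if there is one. Put $\eta_k:=\alpha_k\beta_k$ and $x_k^+:=x_k-\eta_kP_k^{-1}\nabla f(x_k)$ (so $x_\ell^+=x_\ell$ at a terminal index $\ell$). Assume there exists $R>0$ with $\sup_{k\ge0}\|y_k-x^\star\|_\infty\le R$. Suppose that for each $k$ with $\nabla f(x_k)\neq0$ the exact adaptive step is used: $$\eta_k=\bar\eta(P_k^{-1},\nabla f(x_k)),\qquad \alpha_k=\sqrt{\frac{\eta_k}{2}},\qquad \widetilde\alpha_k=\frac{\alpha_k}{1+\alpha_k},\qquad \gamma_k=\frac{\widetilde\alpha_k}{R^2},$$ and that for all $k\ge0$ (for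 which $\eta_{k+1}$ is defined, i.e. $x_{k+1}$ is generated and $\nabla f(x_{k+1})\neq0$) $$2\widetilde\alpha_k^2=\frac{2\alpha_k^2}{(1+\alpha_k)^2}\le\eta_{k+1}.$$ Then $$\rho_k:=\prod_{j=0}^k(1+\alpha_j)^{-1}=\mathcal{O}(k^{-2}),$$ and hence $$\mathcal{E}_{k+1}=\mathcal{O}(k^{-2}),\qquad\text{where}\quad \mathcal{E}_k:=f(x_k^+)-f(x^\star)+\tfrac12\|y_k-x^\star\|_{P_k}^2 .$$
   Context: $\mathcal{S}_L$ ($L>0$) is the set of differentiable convex functions $f:\mathbb{R}^d\to\mathbb{R}$ whose gradient is $L$-Lipschitz in the Euclidean norm. For a symmetric matrix $A$, $\|x\|_A^2:=\langle Ax,x\rangle$; $A\succ0$ means symmetric positive definite. $\|\cdot\|_\infty$ is the maximum norm. For $P\succ0$ and $g\ne0$, $$\bar\eta(P^{-1},g):=\frac1L\,\frac{\|g\|_{P^{-1}}^2}{\|g\|_{P^{-2}}^2}.$$ The parameters satisfy $\alpha_k,\beta_k,\gamma_k>0$; since $\eta_k=\alpha_k\beta_k$, the choice of $\eta_k$ and $\alpha_k$ determines $\beta_k=\eta_k/\alpha_k$. The update of $P$ is implicit; its positive definite diagonal solution is $P_{k+1}=\frac{1-\widetilde\alpha_k}{2}P_k+\frac12\sqrt{(1-\widetilde\alpha_k)^2P_k^2+4\widetilde\alpha_k\gamma_kG_{k+1}^2}$ (entrywise square root on the diagonal). If $\nabla f(x_\ell)=0$, then $x_\ell$ is a minimizer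 and the method stops there. The notation $a_k=\mathcal{O}(k^{-2})$ means that there is a constant $C$, independent of $k$, with $a_k\le Ck^{-2}$ for all $k\ge1$ for which $a_k$ is defined (all $k\ge1$ if the method never terminates). *)

(* Defs.v *)
From HB Require Import structures.
From mathcomp Require Import all_boot all_order all_algebra.
From mathcomp Require Import all_classical all_reals all_analysis.

Set Implicit Arguments.
Unset Strict Implicit.
Unset Printing Implicit Defensive.

Import Order.TTheory GRing.Theory Num.Theory.
Import numFieldNormedType.Exports.

Local Open Scope classical_set_scope.
Local Open Scope ring_scope.

(* Points of R^d are column vectors.  The canonical norm `|x| on 'cV[R]_d is
   the maximum norm, so the Euclidean structure is introduced separately. *)

Definition dotp (R : realType) (d : nat) (x y : 'cV[R]_d) : R :=
  \sum_(i < d) x i 0 * y i 0.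

Definition enorm (R : realType) (d : nat) (x : 'cV[R]_d) : R :=
  Num.sqrt (dotp x x).

(* ||x||_A^2; it is already the square, and A is not required to be positive. *)
Definition sqnorm (R : realType) (d : nat) (A : 'M[R]_d) (x : 'cV[R]_d) : R :=
  dotp (A *m x) x.

Definition posdef (R : realType) (d : nat) (A : 'M[R]_d) : Prop :=
  A^T = A /\ forall x : 'cV[R]_d, x != 0 -> 0 < sqnorm A x.

(* The gradient only when f is differentiable at x, since it consists of the
   partial derivatives. *)
Definition grad (R : realType) (d : nat) (f : 'cV[R]_d -> R) (x : 'cV[R]_d)
  : 'cV[R]_d := \col_(i < d) 'D_(delta_mx i 0) f x.

Definition smooth_convex (R : realType) (d : nat) (L : R)
    (f : 'cV[R]_d -> R) : Prop :=
  [/\ forall x, differentiable f x,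
      convex_function [set: convex_lmodType 'cV[R]_d] (f : 'cV[R]_d -> R^o)
    & forall x z, enorm (grad f x - grad f z) <= L * enorm (x - z)].

Definition argmin (R : realType) (d : nat) (f : 'cV[R]_d -> R)
  : set 'cV[R]_d := [set x | forall z, f x <= f z].

(* The first argument of eta_bar after L is the inverse preconditioner
   Q = P^-1, so that Q ^+ 2 is P^-2. *)
Definition eta_bar (R : realType) (d : nat) (L : R) (Q : 'M[R]_d)
    (g : 'cV[R]_d) : R :=
  L^-1 * (sqnorm Q g / sqnorm (Q ^+ 2) g).

Definition Gsq (R : realType) (d : nat) (f : 'cV[R]_d -> R) (x : 'cV[R]_d)
  : 'M[R]_d := diag_mx (\row_(i < d) (grad f x i 0) ^+ 2).

(* Termination.  Sequences are total functions on nat, but their values are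
   meaningful only up to the first index l with grad f (x l) = 0.
   [generated f x k] says that k <= l (iterates exist at k), and
   [active f x k] that k < l (parameters exist at k, and a step is made). *)
Definition generated (R : realType) (d : nat) (f : 'cV[R]_d -> R)
    (x : nat -> 'cV[R]_d) (k : nat) : Prop :=
  forall j, (j < k)%N -> grad f (x j) != 0.

Definition active (R : realType) (d : nat) (f : 'cV[R]_d -> R)
    (x : nat -> 'cV[R]_d) (k : nat) : Prop :=
  forall j, (j <= k)%N -> grad f (x j) != 0.

(* alphat stands for alpha with a tilde. *)
Record iteration (R : realType) (d : nat) (f : 'cV[R]_d -> R)
    (x y : nat -> 'cV[R]_d) (P : nat -> 'M[R]_d)
    (alpha alphat beta gamma : nat -> R) : Prop := Iteration {
  iter_P0 : is_diag_mx (P 0%N) /\ posdef (P 0%N);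
  iter_param : forall k, active f x k ->
    [/\ 0 < alpha k, 0 < beta k & 0 < gamma k];
  iter_x : forall k, active f x k ->
    (alpha k)^-1 *: (x k.+1 - x k)
    = y k - x k.+1 - beta k *: (invmx (P k) *m grad f (x k));
  iter_P : forall k, active f x k ->
    [/\ is_diag_mx (P k.+1), posdef (P k.+1) &
        (alphat k)^-1 *: (P k.+1 - P k)
        = - P k + gamma k *: (invmx (P k.+1) *m Gsq f (x k.+1))];
  iter_y : forall k, active f x k ->
    (alphat k)^-1 *: (y k.+1 - y k)
    = - (invmx (P k.+1) *m grad f (x k.+1)) }.

(* x_k^+; at a terminal index the gradient vanishes and xplus is x k whatever
   the value of eta k. *)
Definition xplus (R : realType) (d : nat) (f : 'cV[R]_d -> R)
    (x : nat -> 'cV[R]_d) (P : nat -> 'M[R]_d) (eta : nat -> R) (k : nat)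
  : 'cV[R]_d :=
  x k - eta k *: (invmx (P k) *m grad f (x k)).

Definition energy (R : realType) (d : nat) (f : 'cV[R]_d -> R)
    (xs : 'cV[R]_d) (x y : nat -> 'cV[R]_d) (P : nat -> 'M[R]_d)
    (eta : nat -> R) (k : nat) : R :=
  f (xplus f x P eta k) - f xs + 2^-1 * sqnorm (P k) (y k - xs).

Definition rho (R : realType) (alpha : nat -> R) (k : nat) : R :=
  \prod_(j < k.+1) (1 + alpha j)^-1.

(* a_k = O(k^-2) over the indices k >= 1 at which a_k is defined. *)
Definition bigO_inv_sq (R : realType) (dom : nat -> Prop) (a : nat -> R)
  : Prop :=
  exists C : R, forall k, (1 <= k)%N -> dom k -> a k <= C * k%:R ^- 2.

(* Main.v *)
Require Import Defs.
From HB Require Import structures.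
From mathcomp Require Import all_boot all_order all_algebra.
From mathcomp Require Import all_classical all_reals all_analysis.
From mathcomp Require Import ring lra.

Set Implicit Arguments.
Unset Strict Implicit.
Unset Printing Implicit Defensive.

Import Order.TTheory GRing.Theory Num.Theory.
Import numFieldNormedType.Exports.

Local Open Scope classical_set_scope.
Local Open Scope ring_scope.

(** Two facts carry the result.

    The energy contracts: [E k.+1 <= (1 + alpha k)^-1 * E k], so that
    [E k.+1 <= rho k * E 0].  The exact step decreases [f] between [x k.+1]
    and [xplus k.+1] by [eta k.+1 / 2] times the squared norm of the gradient
    in the inverse preconditioner.  In the distance term, the update of [y]
    and the growth of [P] (controlled by the maximum-norm bound on [y - xs]
    and the choice of [gamma]) together cost [alphat k ^+ 2] times the same
    squared norm; the compatibility condition makes the decrease absorb this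
    cost.  The remaining inner products cancel against the first-order
    convexity inequalities at [x k.+1], see [energy_contraction].

    The product decays quadratically.  The update of [P] gives
    [P k.+1 >= (1 + alpha k)^-1 *: P k] entrywise, hence
    [P k.+1 >= m * rho k] where [m] bounds the diagonal of [P 0] from below.
    The exact step is at least the smallest diagonal entry of the
    preconditioner divided by [L], so [alpha k.+1 ^+ 2 >= c ^+ 2 * rho k] for
    a constant [c > 0].  Since [rho k.+1 = rho k / (1 + alpha k.+1)], the
    quantity [rho k ^- (1/2)] then increases by at least a fixed amount at
    each step, see [rho_quadratic_decay].

    The first-order inequality and the descent estimate are both derived from
    one two-sided quadratic bound, a consequence of the mean value theorem
    along a line and of the Lipschitz gradient. *)

(** * Inner product *)

Lemma dotpC (R : realType) (d : nat) (u v : 'cV[R]_d) : dotp u v = dotp v u.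
Proof. by apply: eq_bigr => i _; rewrite mulrC. Qed.

Lemma dotpDl (R : realType) (d : nat) (u v w : 'cV[R]_d) :
  dotp (u + v) w = dotp u w + dotp v w.
Proof. by rewrite -big_split; apply: eq_bigr => i _; rewrite mxE mulrDl. Qed.

Lemma dotpZl (R : realType) (d : nat) (a : R) (u v : 'cV[R]_d) :
  dotp (a *: u) v = a * dotp u v.
Proof. by rewrite mulr_sumr; apply: eq_bigr => i _; rewrite mxE mulrA. Qed.

Lemma dotpBl (R : realType) (d : nat) (u v w : 'cV[R]_d) :
  dotp (u - v) w = dotp u w - dotp v w.
Proof. by rewrite -scaleN1r dotpDl dotpZl mulN1r. Qed.

Lemma dotpDr (R : realType) (d : nat) (u v w : 'cV[R]_d) :
  dotp w (u + v) = dotp w u + dotp w v.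
Proof. by rewrite !(dotpC w) dotpDl. Qed.

Lemma dotpZr (R : realType) (d : nat) (a : R) (u v : 'cV[R]_d) :
  dotp v (a *: u) = a * dotp v u.
Proof. by rewrite !(dotpC v) dotpZl. Qed.

Lemma dotpBr (R : realType) (d : nat) (u v w : 'cV[R]_d) :
  dotp w (u - v) = dotp w u - dotp w v.
Proof. by rewrite !(dotpC w) dotpBl. Qed.

Lemma dotp_ge0 (R : realType) (d : nat) (u : 'cV[R]_d) : 0 <= dotp u u.
Proof. by apply: sumr_ge0 => i _; rewrite -expr2 sqr_ge0. Qed.

(** A consequence of the Cauchy-Schwarz inequality, obtained by expanding
    the square of [w - c *: v] and of [w + c *: v]. *)
Lemma norm_dotp_le (R : realType) (d : nat) (c : R) (w v : 'cV[R]_d) :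
  0 < c -> dotp w w <= c ^+ 2 * dotp v v -> `|dotp w v| <= c * dotp v v.
Proof.
move=> c0 h.
have h1 := dotp_ge0 (w + (- c) *: v); have h2 := dotp_ge0 (w + c *: v).
rewrite !(dotpDl, dotpDr, dotpZl, dotpZr) (dotpC v w) in h1 h2.
have e1 : c * dotp w v <= c * (c * dotp v v) by lra.
have e2 : - (c * (c * dotp v v)) <= c * dotp w v by lra.
by rewrite ler_norml -(ler_pM2l c0) mulrN e2 -(ler_pM2l c0) e1.
Qed.

Lemma dotp_le_of_enorm_le (R : realType) (d : nat) (c : R) (u v : 'cV[R]_d) :
  0 <= c -> enorm u <= c * enorm v -> dotp u u <= c ^+ 2 * dotp v v.
Proof.
move=> c0; rewrite /enorm => h.
rewrite -(sqr_sqrtr (dotp_ge0 u)) -(sqr_sqrtr (dotp_ge0 v)) -exprMn.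
by rewrite ler_pXn2r // nnegrE ?mulr_ge0 ?sqrtr_ge0.
Qed.

(** * Smooth convex functions *)

Lemma diff_eq_dotp_grad (R : realType) (d : nat) (f : 'cV[R]_d -> R)
    (x v : 'cV[R]_d) :
  differentiable f x -> 'd f x v = dotp (grad f x) v.
Proof.
move=> df; rewrite {1}(matrix_sum_delta v) linear_sum /=.
apply: eq_bigr => i _; rewrite big_ord1 linearZ /= mxE deriveE //.
by rewrite mulrC.
Qed.

Lemma is_derive_line (R : realType) (d : nat) (f : 'cV[R]_d -> R)
    (x v : 'cV[R]_d) (t : R) :
  (forall z, differentiable f z) ->
  is_derive t 1 (fun s : R => f (x + s *: v)) (dotp (grad f (x + t *: v)) v).
Proof.
move=> df.
have dl : is_diff t (fun s : R => x + s *: v) (fun s => s *: v).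
  by apply: is_diff_eq (is_diffD (is_diff_cst x t) (is_diff_scalel t v)) _;
    rewrite add0r.
have dc : differentiable (f \o (fun s : R => x + s *: v)) t.
  by apply: differentiable_comp.
apply: DeriveDef; first exact: diff_derivable.
rewrite deriveE // diff_comp //= diff_val scale1r.
exact: diff_eq_dotp_grad.
Qed.

(** First-order Taylor estimate on [0, 1] for a function whose derivative is
    Lipschitz at [0]; it follows from the mean value theorem applied to
    [h t - h' 0 * t -+ M / 2 * t ^+ 2]. *)
Lemma taylor1_lipschitz (R : realType) (M : R) (h h' : R -> R) :
  (forall t : R, is_derive t 1 h (h' t)) ->
  (forall t : R, 0 < t -> `|h' t - h' 0| <= M * t) ->
  `|h 1 - h 0 - h' 0| <= M / 2.
Proof.
move=> dh lip.
have key (m : R) : exists2 c, 0 < c &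
    h 1 - h 0 - h' 0 - m = h' c - h' 0 - 2 * m * c.
  pose q := h - ((h' 0) \*: id) - (m \*: (id ^+ 2)) : R -> R.
  have qE t : q t = h t - h' 0 * t - m * t ^+ 2 by [].
  have dq (t : R) : is_derive t 1 q (h' t - h' 0 - 2 * m * t).
    apply: is_derive_eq; rewrite /GRing.scale /= ; ring.
  have [|c] := @MVT R q _ 0 1 ltr01 (fun t _ => dq t).
    apply: continuous_subspaceT => t.
    apply: differentiable_continuous; apply/derivable1_diffP.
    exact: (@ex_derive _ _ _ _ _ _ _ (dq t)).
  rewrite in_itv /= => /andP[c0 _] e; exists c => //.
  rewrite -[RHS]mulr1 -[X in _ * X](subr0 1) -e !qE.
  ring.
have [c1 c10 e1] := key (M / 2); have [c2 c20 e2] := key (- (M / 2)).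
have := lip _ c10; have := lip _ c20.
rewrite !ler_norml => /andP[? ?] /andP[? ?]; apply/andP; split; lra.
Qed.

Lemma smooth_quadratic_bound (R : realType) (d : nat) (L : R)
    (f : 'cV[R]_d -> R) (x v : 'cV[R]_d) :
  0 < L -> smooth_convex L f ->
  `|f (x + v) - f x - dotp (grad f x) v| <= L / 2 * dotp v v.
Proof.
move=> L0 [df _ lip].
have := @taylor1_lipschitz R (L * dotp v v) (fun t => f (x + t *: v))
  (fun t => dotp (grad f (x + t *: v)) v) (fun t => is_derive_line x v t df).
rewrite scale1r scale0r addr0 mulrAC; apply => t t0.
rewrite -dotpBl mulrAC; apply: norm_dotp_le; first exact: mulr_gt0.
have := lip (x + t *: v) x.
move/(dotp_le_of_enorm_le (ltW L0))/le_trans; apply.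
rewrite addrC addKr dotpZl dotpZr exprMn; lra.
Qed.

Lemma convex_function_segment (R : realType) (d : nat) (f : 'cV[R]_d -> R)
    (x z : 'cV[R]_d) (t : R) :
  convex_function [set: convex_lmodType 'cV[R]_d] (f : 'cV[R]_d -> R^o) ->
  0 <= t <= 1 -> f (x + t *: (z - x)) <= f x + t * (f z - f x).
Proof.
move=> cf /andP[t0 t1].
pose t' := Itv01 t0 t1.
have := cf t' z x; rewrite !inE => /(_ I I); rewrite convRE /conv /=.
rewrite [t *: z + _](_ : _ = x + t *: (z - x)); last first.
  by rewrite /unstable.onem scalerBl scalerBr scale1r addrC -addrA (addrC (- _)).
by move/le_trans; apply; rewrite /unstable.onem; lra.
Qed.

(** Convexity bounds [f (x + t *: v)] from above by the chord, smoothness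
    bounds it from below up to an error of order [t ^+ 2]; a small [t]
    gives the first-order inequality. *)
Lemma smooth_convex_grad_le (R : realType) (d : nat) (L : R)
    (f : 'cV[R]_d -> R) (x z : 'cV[R]_d) :
  0 < L -> smooth_convex L f -> f x + dotp (grad f x) (z - x) <= f z.
Proof.
move=> L0 sf; have [_ cf _] := sf.
set v := z - x; set g := dotp _ _.
rewrite leNgt; apply/negP => lt.
pose e := f x + g - f z; have e0 : 0 < e by rewrite subr_gt0.
pose q := L / 2 * dotp v v.
have q0 : 0 <= q by rewrite mulr_ge0 ?dotp_ge0 // divr_ge0 ?ltW.
pose t := e / (e + q).
have eq0 : 0 < e + q by rewrite ltr_wpDr.
have t0 : 0 < t by rewrite divr_gt0.
have t1 : t <= 1 by rewrite ler_pdivrMr // mul1r lerDl.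
have := @convex_function_segment R d f x z t cf; rewrite t1 (ltW t0) => /(_ isT).
rewrite -/v.
have := smooth_quadratic_bound x (t *: v) L0 sf.
rewrite !dotpZr dotpZl -/g ler_norml => /andP[lb _] ub.
have te : t * (e + q) = e by rewrite divfK // gt_eqF.
have h : t * e <= t * (q * t) by rewrite /e /q; lra.
rewrite ler_pM2l // in h.
have : 0 < t * e by exact: mulr_gt0.
lra.
Qed.

(** * Diagonal preconditioners *)

Lemma diag_posdefE (R : realType) (d : nat) (A : 'M[R]_d) :
  is_diag_mx A -> posdef A ->
  exists p : 'rV[R]_d, A = diag_mx p /\ forall i, 0 < p 0 i.
Proof.
move=> /diag_mxP[p ->] [_ pos]; exists p; split=> // i.
have /pos : delta_mx i 0 != 0 :> 'cV[R]_d.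
  apply/eqP => /matrixP/(_ i 0); rewrite !mxE !eqxx => /eqP.
  by rewrite oner_eq0.
rewrite /sqnorm /dotp (bigD1 i) //= big1 => [|j ji].
  by rewrite mul_diag_mx !mxE !eqxx !mulr1 addr0.
by rewrite !mxE (negPf ji) mulr0.
Qed.

(** Entrywise inverse of a row vector. *)
Definition invrow (R : realType) (d : nat) (p : 'rV[R]_d) : 'rV[R]_d :=
  \row_i (p 0 i)^-1.

Lemma invmx_diag (R : realType) (d : nat) (p : 'rV[R]_d) :
  (forall i, 0 < p 0 i) -> invmx (diag_mx p) = diag_mx (invrow p).
Proof.
move=> p0.
have e : diag_mx p *m diag_mx (invrow p) = 1%:M.
  rewrite mulmx_diag -diag_const_mx; congr diag_mx; apply/rowP => i.
  by rewrite !mxE mulfV // gt_eqF.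
have [u _] := mulmx1_unit e.
by rewrite -[LHS]mulmx1 -e mulmxA mulVmx // mul1mx.
Qed.

Lemma invrow_gt0 (R : realType) (d : nat) (p : 'rV[R]_d) :
  (forall i, 0 < p 0 i) -> forall i, 0 < invrow p 0 i.
Proof. by move=> p0 i; rewrite mxE invr_gt0. Qed.

Lemma sqnorm_diag (R : realType) (d : nat) (p : 'rV[R]_d) (x : 'cV[R]_d) :
  sqnorm (diag_mx p) x = \sum_i p 0 i * x i 0 ^+ 2.
Proof.
by apply: eq_bigr => i _; rewrite mul_diag_mx mxE expr2 mulrA.
Qed.

Lemma sqnorm_diag_sqr (R : realType) (d : nat) (q : 'rV[R]_d) (x : 'cV[R]_d) :
  sqnorm (diag_mx q ^+ 2) x = \sum_i q 0 i ^+ 2 * x i 0 ^+ 2.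
Proof.
rewrite expr2 -[_ * _]/(_ *m _) mulmx_diag sqnorm_diag.
by apply: eq_bigr => i _; rewrite mxE -expr2.
Qed.

Lemma dotp_diag_mul (R : realType) (d : nat) (q : 'rV[R]_d) (x : 'cV[R]_d) :
  dotp (diag_mx q *m x) (diag_mx q *m x) = sqnorm (diag_mx q ^+ 2) x.
Proof.
rewrite sqnorm_diag_sqr; apply: eq_bigr => i _.
by rewrite mul_diag_mx mxE; ring.
Qed.

Lemma sqnorm_diag_sqr_gt0 (R : realType) (d : nat) (q : 'rV[R]_d)
    (x : 'cV[R]_d) :
  (forall i, 0 < q 0 i) -> x != 0 -> 0 < sqnorm (diag_mx q ^+ 2) x.
Proof.
move=> q0 x0; have [i xi0] : exists i, x i 0 != 0.
  apply/existsP; apply: contraNT x0; rewrite negb_exists => /forallP h.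
  by apply/eqP/colP => i; rewrite mxE; apply/eqP; have := h i; rewrite negbK.
rewrite sqnorm_diag_sqr (bigD1 i) //=; apply: ltr_pwDl.
  by apply: mulr_gt0; rewrite ?(exprn_gt0 _ (q0 i)) // lt_def sqrf_eq0 xi0 sqr_ge0.
by apply: sumr_ge0 => j _; rewrite mulr_ge0 ?sqr_ge0.
Qed.

Lemma exists_pos_lower_bound (R : realType) (d : nat) (p : 'rV[R]_d) :
  (forall i, 0 < p 0 i) -> exists2 m, 0 < m & forall i, m <= p 0 i.
Proof.
move=> p0; exists (\big[Order.min/1]_i p 0 i); first exact: lt_bigmin.
by move=> i; apply: bigmin_le_cond.
Qed.

(** The exact step is bounded below by the smallest diagonal entry of the
    preconditioner. *)
Lemma eta_bar_ge (R : realType) (d : nat) (L m : R) (p : 'rV[R]_d)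
    (g : 'cV[R]_d) :
  0 < L -> (forall i, 0 < p 0 i) -> (forall i, m <= p 0 i) -> g != 0 ->
  m / L <= eta_bar L (diag_mx (invrow p)) g.
Proof.
move=> L0 p0 mp g0; rewrite /eta_bar mulrC ler_pM2l ?invr_gt0 //.
rewrite ler_pdivlMr ?sqnorm_diag_sqr_gt0 //; last exact: invrow_gt0.
rewrite sqnorm_diag_sqr sqnorm_diag mulr_sumr; apply: ler_sum => i _.
rewrite mulrA ler_wpM2r ?sqr_ge0 // mxE expr2 mulrA ger_pMl ?invr_gt0 //.
by rewrite ler_pdivrMr ?mul1r.
Qed.

(** * Decrease of the energy *)

(** The exact step is the minimizer of the quadratic upper model of [f] along
    the preconditioned gradient. *)
Lemma exact_step_descent (R : realType) (d : nat) (L : R)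
    (f : 'cV[R]_d -> R) (q : 'rV[R]_d) (x : 'cV[R]_d)
    (eta := eta_bar L (diag_mx q) (grad f x)) :
  0 < L -> smooth_convex L f -> (forall i, 0 < q 0 i) -> grad f x != 0 ->
  f (x - eta *: (diag_mx q *m grad f x))
    <= f x - eta / 2 * sqnorm (diag_mx q) (grad f x).
Proof.
move=> L0 sf q0 g0.
have S0 := sqnorm_diag_sqr_gt0 q0 g0.
have : eta * L * sqnorm (diag_mx q ^+ 2) (grad f x)
       = sqnorm (diag_mx q) (grad f x).
  by rewrite /eta /eta_bar; field; rewrite !gt_eqF.
have := smooth_quadratic_bound x (- eta *: (diag_mx q *m grad f x)) L0 sf.
rewrite !dotpZr dotpZl dotp_diag_mul (dotpC (grad f x)) -/(sqnorm _ _) scaleNr.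
by move: eta => e /ler_normlW h1 h2; nra.
Qed.

(** The distance term, for one step of the preconditioner and of [y]; here
    [w] is [y - xs].  Since [w] is bounded by [r] in the maximum norm, the
    growth of the preconditioner costs no more than a second copy of the
    term [b ^+ 2 / 2] times the squared gradient norm. *)
Lemma preconditioner_potential_step (R : realType) (d : nat) (b r : R)
    (p p' : 'rV[R]_d) (w g : 'cV[R]_d) :
  0 <= b -> 0 < r -> (forall i, 0 < p' 0 i) ->
  (forall i, p' 0 i = (1 - b) * p 0 i
                      + b * (b / r ^+ 2) * (g i 0 ^+ 2 / p' 0 i)) ->
  (forall i, `|w i 0| <= r) ->
  2^-1 * sqnorm (diag_mx p') (w - b *: (diag_mx (invrow p') *m g))
  <= (1 - b) * (2^-1 * sqnorm (diag_mx p) w) - b * dotp g w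
     + b ^+ 2 * sqnorm (diag_mx (invrow p')) g.
Proof.
move=> b0 r0 p0 pE wr.
rewrite !sqnorm_diag /dotp !mulr_sumr -sumrB -big_split /=.
apply: ler_sum => i _; rewrite mul_diag_mx !mxE.
set pi := p' 0 i; set t := b / r ^+ 2 * w i 0 ^+ 2 .
have pi0 : 0 < pi by exact: p0.
have tb : t <= b.
  rewrite /t mulrAC ler_pdivrMr ?exprn_gt0 // ler_wpM2l //.
  by rewrite -(real_normK (num_real (w i 0))) ler_pXn2r // nnegrE ltW.
set s := g i 0 ^+ 2 / pi.
have bs : 0 <= b * s by rewrite mulr_ge0 // divr_ge0 ?sqr_ge0 // ltW.
have e : 2^-1 * (pi * (w i 0 - b * (pi^-1 * g i 0)) ^+ 2)
   = 2^-1 * pi * w i 0 ^+ 2 - b * (g i 0 * w i 0) + 2^-1 * b ^+ 2 * s.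
  by rewrite /s; field; rewrite gt_eqF.
have e2 : pi * w i 0 ^+ 2 = (1 - b) * (p 0 i * w i 0 ^+ 2) + b * s * t.
  by rewrite /pi pE -/pi /t /s; ring.
have e3 : pi^-1 * g i 0 ^+ 2 = s by rewrite mulrC.
have h := ler_wpM2l bs tb.
rewrite e e3 -mulrA e2; lra.
Qed.

(** One step contracts the energy by the factor [(1 + a)^-1]: the inner
    products produced by the two first-order inequalities at [x'] (towards
    [xp] and towards [xs]) and by the potential cancel because
    [x' - xp = a *: (y - x')]. *)
Lemma energy_contraction (R : realType) (d : nat) (L a r : R)
    (f : 'cV[R]_d -> R) (p p' : 'rV[R]_d) (xs xp x' xp' y : 'cV[R]_d)
    (b := a / (1 + a)) (g := grad f x') :
  0 < L -> smooth_convex L f -> 0 < a -> 0 < r -> (forall i, 0 < p' 0 i) ->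
  (forall i, p' 0 i = (1 - b) * p 0 i
                      + b * (b / r ^+ 2) * (g i 0 ^+ 2 / p' 0 i)) ->
  (forall i, `|(y - xs) i 0| <= r) ->
  x' - xp = a *: (y - x') ->
  f xp' <= f x' - b ^+ 2 * sqnorm (diag_mx (invrow p')) g ->
  f xp' - f xs
    + 2^-1 * sqnorm (diag_mx p') (y - b *: (diag_mx (invrow p') *m g) - xs)
  <= (1 + a)^-1 * (f xp - f xs + 2^-1 * sqnorm (diag_mx p) (y - xs)).
Proof.
move=> L0 sf a0 r0 p0 pE yr xE desc.
have a1 : 0 < 1 + a by rewrite addr_gt0.
have b0 : 0 <= b by rewrite divr_ge0 // ltW.
have -> : (1 + a)^-1 = 1 - b by rewrite /b; field; rewrite gt_eqF.
have b1 : 0 <= 1 - b.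
  by rewrite subr_ge0 ler_pdivrMr // mul1r lerDr.
have := preconditioner_potential_step b0 r0 p0 pE yr.
rewrite addrAC => pot.
have c1 := ler_wpM2l b1 (smooth_convex_grad_le x' xp L0 sf).
have c2 := ler_wpM2l b0 (smooth_convex_grad_le x' xs L0 sf).
have ab : a * (1 - b) = b by rewrite /b; field; rewrite gt_eqF.
have e1 : (1 - b) * dotp g (xp - x') = - b * dotp g (y - x').
  have := congr1 (dotp g) xE; rewrite dotpZr !dotpBr => e.
  rewrite -(opprB (dotp g x')) e.
  transitivity (- (a * (1 - b)) * (dotp g y - dotp g x')); first by ring.
  by rewrite ab.
have e2 : dotp g (y - x') = dotp g (y - xs) + dotp g (xs - x').
  by rewrite -dotpDr addrA subrK.
rewrite mulrDr -/g e1 e2 in c1; rewrite mulrDr -/g in c2; lra.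
Qed.

(** * Quadratic decay of the product *)

Lemma rho_gt0 (R : realType) (a : nat -> R) (k : nat) :
  (forall j, (j <= k)%N -> 0 < a j) -> 0 < rho a k.
Proof.
move=> a0; apply: prodr_gt0 => j _; rewrite invr_gt0 addr_gt0 //.
by apply: a0; rewrite -ltnS.
Qed.

Lemma rhoS (R : realType) (a : nat -> R) (k : nat) :
  rho a k.+1 = rho a k / (1 + a k.+1).
Proof. by rewrite /rho big_ord_recr. Qed.

(** If [a j.+1] is at least [c] times the square root of [rho a j], then
    [(rho a j) ^- (1/2)] grows at least linearly, with slope [e] as soon as
    [3 * e <= c] and [e <= 1]. *)
Lemma rho_quadratic_decay (R : realType) (a : nat -> R) (c e : R) (k : nat) :
  0 < e -> e <= 1 -> 3 * e <= c ->
  (forall j, (j <= k)%N -> 0 < a j) ->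
  (forall j, (j < k)%N -> c ^+ 2 * rho a j <= a j.+1 ^+ 2) ->
  e ^+ 2 * k.+1%:R ^+ 2 * rho a k <= 1.
Proof.
move=> e0 e1 ec; elim: k => [|k IH] a0 ha.
  have := a0 0%N isT => a00.
  rewrite /rho big_ord_recr big_ord0 /= mul1r expr1n mulr1.
  rewrite ler_pdivrMr ?addr_gt0 //; nra.
have {}IH : e ^+ 2 * k.+1%:R ^+ 2 * rho a k <= 1.
  by apply: IH => j jk; [apply: a0 | apply: ha]; exact: ltnW.
have r0 : 0 < rho a k by apply: rho_gt0 => j jk; apply: a0; exact: ltnW.
have ak0 : 0 < a k.+1 by exact: a0.
have hk := ha k (ltnSn k).
rewrite rhoS mulrA ler_pdivrMr ?addr_gt0 // mul1r -(natr1 k.+1).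
have n1 : 1 <= k.+1%:R :> R by rewrite ler1n.
move: n1 IH hk r0 ak0; move: (k.+1%:R) (rho a k) (a k.+1) => n r s n1 IH hk r0 s0.
have n0 : 0 < n by exact: lt_le_trans n1.
(* Passing from [n] to [n + 1] adds [2 * e * (e * n) + e ^+ 2] to
   [(e * n) ^+ 2], which is at most [3 * e * (e * n)] since [1 <= n]. *)
have key : 3 * e * (e * n) * r <= s.
  rewrite -(@ler_pXn2r _ 2) // ?nnegrE ?(ltW s0) //; last first.
    by apply/ltW; rewrite !mulr_gt0.
  apply: le_trans hk.
  have -> : (3 * e * (e * n) * r) ^+ 2
            = (3 * e) ^+ 2 * ((e ^+ 2 * n ^+ 2 * r) * r) by ring.
  apply: ler_pM; rewrite ?sqr_ge0 //.
  - by rewrite !mulr_ge0 ?sqr_ge0 // ltW.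
  - by rewrite ler_pXn2r // nnegrE; lra.
  - by rewrite ger_pMl.
have : e ^+ 2 * r <= e ^+ 2 * r * n.
  by rewrite ler_peMr // mulr_ge0 ?sqr_ge0 // ltW.
lra.
Qed.

(** * The iteration *)

Lemma coord_le_norm (R : realType) (d : nat) (w : 'cV[R]_d) (r : R) :
  `|w| <= r -> forall i, `|w i 0| <= r.
Proof.
move=> wr i; apply: le_trans wr; rewrite [leRHS]mx_normrE.
exact: (@le_bigmax _ _ _ 0 (fun ij => `|w ij.1 ij.2| ) (i, 0)).
Qed.

(** The implicit update of the preconditioner, read on the diagonal. *)
Lemma diag_update_coord (R : realType) (d : nat) (b c : R)
    (p p' h : 'rV[R]_d) :
  b != 0 -> (forall i, 0 < p' 0 i) ->
  b^-1 *: (diag_mx p' - diag_mx p)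
    = - diag_mx p + c *: (invmx (diag_mx p') *m diag_mx h) ->
  forall i, p' 0 i = (1 - b) * p 0 i + b * c * (h 0 i / p' 0 i).
Proof.
move=> b0 p0 e i; have := congr1 (fun M : 'M[R]_d => b * M i i) e.
rewrite invmx_diag // mulmx_diag !mxE !eqxx !mulr1n mulVKf // => /eqP.
by rewrite subr_eq => /eqP h'; apply: (etrans h'); ring.
Qed.

Section Run.
Variables (R : realType) (d : nat) (L : R) (f : 'cV[R]_d -> R).
Variables (xs : 'cV[R]_d) (x y : nat -> 'cV[R]_d) (P : nat -> 'M[R]_d).
Variables (alpha alphat beta gamma eta : nat -> R) (radius : R).
Hypotheses (L0 : 0 < L) (sf : smooth_convex L f) (r0 : 0 < radius).
Hypothesis hrun : iteration f x y P alpha alphat beta gamma.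
Hypothesis heta : forall k, active f x k -> eta k = alpha k * beta k.
Hypothesis hy : forall k, generated f x k -> `|y k - xs| <= radius.
Hypothesis hstep : forall k, active f x k ->
  [/\ eta k = eta_bar L (invmx (P k)) (grad f (x k)),
      alpha k = Num.sqrt (eta k / 2),
      alphat k = alpha k / (1 + alpha k)
    & gamma k = alphat k / radius ^+ 2].
Hypothesis hcomp :
  forall k, active f x k.+1 -> 2 * alphat k ^+ 2 <= eta k.+1.

Lemma active_le (j k : nat) : (j <= k)%N -> active f x k -> active f x j.
Proof. by move=> jk h i ij; apply: h; exact: leq_trans jk. Qed.

Lemma active_generated (k : nat) : active f x k -> generated f x k.
Proof. by move=> h i ik; apply: h; exact: ltnW. Qed.

Lemma active_alpha_gt0 (k : nat) : active f x k -> 0 < alpha k.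
Proof. by case/(iter_param hrun). Qed.

Lemma preconditioner_diag (k : nat) : generated f x k ->
  exists p : 'rV[R]_d, P k = diag_mx p /\ forall i, 0 < p 0 i.
Proof.
case: k => [_|k hk]; first by have [? ?] := iter_P0 hrun; exact: diag_posdefE.
by have [? ? _] := iter_P hrun hk; exact: diag_posdefE.
Qed.

Lemma preconditioner_step (k : nat) (p p' : 'rV[R]_d) :
  active f x k -> P k = diag_mx p -> P k.+1 = diag_mx p' ->
  (forall i, 0 < p' 0 i) ->
  forall i, p' 0 i = (1 - alphat k) * p 0 i
    + alphat k * (alphat k / radius ^+ 2)
      * (grad f (x k.+1) i 0 ^+ 2 / p' 0 i).
Proof.
move=> hk Pp Pp' p0 i.
have a0 := active_alpha_gt0 hk; have [_ _ bE gE] := hstep hk.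
have b0 : alphat k != 0.
  by rewrite bE gt_eqF // divr_gt0 // addr_gt0.
have [_ _] := iter_P hrun hk; rewrite Pp Pp' gE => /(diag_update_coord b0 p0) h.
by apply: (etrans (h i)); rewrite mxE.
Qed.

(** The gradient step that enters the energy; at a terminal index it is
    void, and at the others the step is exact and at least
    [2 * alphat k ^+ 2]. *)
Lemma xplus_descent (k : nat) (p' : 'rV[R]_d) :
  active f x k -> P k.+1 = diag_mx p' -> (forall i, 0 < p' 0 i) ->
  f (xplus f x P eta k.+1) <= f (x k.+1)
    - alphat k ^+ 2 * sqnorm (diag_mx (invrow p')) (grad f (x k.+1)).
Proof.
move=> hk Pp' p0; rewrite /xplus Pp' invmx_diag //.
have q0 := invrow_gt0 p0.
have [g0|g0] := eqVneq (grad f (x k.+1)) 0.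
  rewrite g0 mulmx0 scaler0 subr0 /sqnorm mulmx0.
  by rewrite /dotp big1 ?mulr0 ?subr0 // => i _; rewrite mxE mul0r.
have hk1 : active f x k.+1.
  by move=> j; rewrite leq_eqVlt => /predU1P[->//|]; exact: hk.
have [etaE _ _ _] := hstep hk1; rewrite Pp' invmx_diag // in etaE.
have := exact_step_descent L0 sf q0 g0; rewrite -etaE => /le_trans; apply.
rewrite lerD2l lerN2 ler_wpM2r //.
  by rewrite sqnorm_diag sumr_ge0 // => i _; rewrite mulr_ge0 ?sqr_ge0 // ltW.
by have := hcomp hk1; lra.
Qed.

Lemma energy_step (k : nat) : active f x k ->
  energy f xs x y P eta k.+1 <= (1 + alpha k)^-1 * energy f xs x y P eta k.
Proof.
move=> hk; have hg : generated f x k.+1 := hk.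
have [p [Pp _]] := preconditioner_diag (active_generated hk).
have [p' [Pp' p0]] := preconditioner_diag hg.
have a0 := active_alpha_gt0 hk; have [_ _ bE gE] := hstep hk.
have b0 : alphat k != 0.
  by rewrite bE gt_eqF // divr_gt0 // addr_gt0.
have yE : y k.+1
    = y k - alphat k *: (diag_mx (invrow p') *m grad f (x k.+1)).
  have := congr1 (fun v => alphat k *: v) (iter_y hrun hk).
  rewrite /= scalerA mulfV // scale1r Pp' invmx_diag // scalerN => <-.
  by rewrite addrC subrK.
have xE : x k.+1 - xplus f x P eta k = alpha k *: (y k - x k.+1).
  have := congr1 (fun v => alpha k *: v) (iter_x hrun hk).
  rewrite /= scalerA mulfV ?gt_eqF // scale1r scalerBr scalerA -heta // => e.
  by rewrite /xplus opprB addrCA e addrC subrK.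
have pE := preconditioner_step hk Pp Pp' p0.
have desc := xplus_descent hk Pp' p0.
have yr := coord_le_norm (hy (active_generated hk)).
rewrite bE in pE desc yE; rewrite /energy Pp Pp' yE.
exact: (energy_contraction L0 sf a0 r0 p0 pE yr xE desc).
Qed.

(** The update of the preconditioner adds a nonnegative term to
    [(1 - alphat k) *: P k], so its entries decay no faster than the product
    of the [(1 + alpha j)^-1]. *)
Lemma preconditioner_ge (m : R) :
  0 < m -> (forall i, m <= P 0%N i i) ->
  forall k, generated f x k ->
    forall i, m * \prod_(j < k) (1 + alpha j)^-1 <= P k i i.
Proof.
move=> m0 mP; elim=> [|k IH] hk i; first by rewrite big_ord0 mulr1.
have ha : active f x k := hk.
have [p [Pp _]] := preconditioner_diag (active_generated ha).
have [p' [Pp' p0]] := preconditioner_diag hk.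
have a0 := active_alpha_gt0 ha; have [_ _ bE _] := hstep ha.
have a1 : 0 < 1 + alpha k by rewrite addr_gt0.
have b0 : 0 < alphat k by rewrite bE divr_gt0.
have := IH (active_generated ha) i.
rewrite big_ord_recr mulrA Pp Pp' !mxE !eqxx !mulr1n => h.
rewrite (preconditioner_step ha Pp Pp' p0).
have -> : 1 - alphat k = (1 + alpha k)^-1.
  by rewrite bE; field; rewrite gt_eqF.
rewrite mulrC; apply: ler_wpDr; last by rewrite ler_pM2l ?invr_gt0.
apply: mulr_ge0; last by rewrite divr_ge0 ?sqr_ge0 // ltW.
by rewrite mulr_ge0 ?divr_ge0 ?sqr_ge0 // ltW.
Qed.

Lemma energy_le_prod (k : nat) : generated f x k ->
  energy f xs x y P eta k
    <= (\prod_(j < k) (1 + alpha j)^-1) * energy f xs x y P eta 0.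
Proof.
elim: k => [_|k IH hk]; first by rewrite big_ord0 mul1r.
have ha : active f x k := hk.
apply: le_trans (energy_step ha) _.
rewrite big_ord_recr /= mulrAC mulrC ler_pM2r; last first.
  by rewrite invr_gt0 addr_gt0 // active_alpha_gt0.
exact/IH/active_generated.
Qed.

Lemma energy0_ge0 : argmin f xs -> 0 <= energy f xs x y P eta 0.
Proof.
move=> hxs; have [//|p [Pp p0]] := @preconditioner_diag 0%N.
rewrite /energy addr_ge0 ?subr_ge0 ?hxs // mulr_ge0 ?invr_ge0 // Pp.
by rewrite sqnorm_diag sumr_ge0 // => i _; rewrite mulr_ge0 ?sqr_ge0 // ltW.
Qed.

(** The exact step is at least [m / L] times the previous product, by the
    lower bound on the preconditioner; hence [alpha j.+1 ^+ 2] is at least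
    [m / L / 2 * rho alpha j], which is the hypothesis of the quadratic
    decay. *)
Lemma rho_bigO : exists2 C : R, 0 <= C &
  forall k, (1 <= k)%N -> active f x k -> rho alpha k <= C * k%:R ^- 2.
Proof.
have [//|p [Pp p0]] := @preconditioner_diag 0%N.
have [m m0 mp] := exists_pos_lower_bound p0.
have mP i : m <= P 0%N i i by rewrite Pp mxE eqxx mulr1n.
pose c := Num.sqrt (m / L / 2).
have mL0 : 0 < m / L / 2 by rewrite !divr_gt0.
have c0 : 0 < c by rewrite sqrtr_gt0.
pose e := Num.min 1 (c / 3).
have e0 : 0 < e by rewrite lt_min ltr01 divr_gt0.
have e1 : e <= 1 by rewrite ge_min lexx.
have ec : 3 * e <= c.
  by rewrite mulrC -ler_pdivlMr // ge_min lexx orbT.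
exists (e ^- 2) => [|k k1 hk]; first by rewrite invr_ge0 sqr_ge0.
have apos j : (j <= k)%N -> 0 < alpha j.
  by move=> jk; apply/active_alpha_gt0/active_le/hk.
have alow j : (j < k)%N -> c ^+ 2 * rho alpha j <= alpha j.+1 ^+ 2.
  move=> jk; have hj : active f x j.+1 by exact: active_le hk.
  have [p' [Pp' p0']] := preconditioner_diag (active_generated hj).
  have [etaE aE _ _] := hstep hj.
  have lb i : m * rho alpha j <= p' 0 i.
    have := preconditioner_ge m0 mP (active_generated hj) i.
    by rewrite Pp' mxE eqxx mulr1n.
  have := eta_bar_ge L0 p0' lb (hj _ (leqnn _)).
  rewrite -invmx_diag // -Pp' -etaE => le_eta.
  rewrite aE !sqr_sqrtr ?(ltW mL0) //; first lra.
  apply: divr_ge0 => //; apply: le_trans le_eta.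
  apply: divr_ge0 (ltW L0); apply: mulr_ge0; first exact: ltW.
  by apply/ltW/rho_gt0 => i ij; apply: apos; apply: leq_trans ij (ltnW jk).
have := rho_quadratic_decay e0 e1 ec apos alow.
have k0 : 0 < k%:R :> R by rewrite ltr0n.
move=> dec; rewrite -invfM -exprMn -[leRHS]mul1r ler_pdivlMr; last first.
  by rewrite exprn_gt0 // mulr_gt0.
apply: le_trans dec; rewrite mulrC exprMn ler_wpM2r //.
  by apply/ltW/rho_gt0.
by rewrite ler_wpM2l ?sqr_ge0 // ler_pXn2r ?nnegrE ?ler_nat.
Qed.

End Run.

Theorem proposition4p1 (R : realType) (d : nat) (L : R) (hL : 0 < L)
    (f : 'cV[R]_d -> R) (hf : smooth_convex L f)
    (xs : 'cV[R]_d) (hxs : argmin f xs)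
    (x y : nat -> 'cV[R]_d) (P : nat -> 'M[R]_d)
    (alpha alphat beta gamma eta : nat -> R)
    (hrun : iteration f x y P alpha alphat beta gamma)
    (heta : forall k, active f x k -> eta k = alpha k * beta k)
    (radius : R) (hradius : 0 < radius)
    (hy : forall k, generated f x k -> `|y k - xs| <= radius)
    (hstep : forall k, active f x k ->
       [/\ eta k = eta_bar L (invmx (P k)) (grad f (x k)),
           alpha k = Num.sqrt (eta k / 2),
           alphat k = alpha k / (1 + alpha k)
         & gamma k = alphat k / radius ^+ 2])
    (hcomp : forall k, active f x k.+1 -> 2 * alphat k ^+ 2 <= eta k.+1) :
  bigO_inv_sq (active f x) (rho alpha) /\
  bigO_inv_sq (fun k => generated f x k.+1)
    (fun k => energy f xs x y P eta k.+1).

Proof.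
have [C C0 hC] := rho_bigO hL hrun hstep.
split; first by exists C.
exists (C * energy f xs x y P eta 0) => k k1 hk.
have E0 : 0 <= energy f xs x y P eta 0 by exact: energy0_ge0 hrun hxs.
have := energy_le_prod hL hf hradius hrun heta hy hstep hcomp hk.
move/le_trans; apply.
by rewrite mulrAC ler_wpM2r // hC.
Qed.
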